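(* Let $h_1\ge h_2\ge h_3>0$ and $h_4\ge 0$ be integers and let $n=h_1+h_2+h_3+h_4$. Then: (i) if $h_4\ge h_1$, an $\mathrm{ILS}(n;h_1h_2h_3)$ exists; (ii) if $h_1>h_4\ge h_3$, an $\mathrm{ILS}(n;h_1h_2h_3)$ exists if and only if $h_4\ge h_1-h_3$; (iii) if $h_4<h_3$, an $\mathrm{ILS}(n;h_1h_2h_3)$ exists if and only if both $$h_4\ge h_2+h_3-2\frac{h_2h_3}{h_1}$$ and $$h_4^2+h_4(2h_1-h_2-h_3)-h_1h_2-h_1h_3+2h_2h_3\ge 0.$$
   Context: A latin square of order $n$ is an $n\times n$ array filled with symbols from $\{1,\dots,n\}$ such that each symbol occurs exactly once in every row and every column. A subsquare of order $m$ is an $m\times m$ subarray (given by a set of $m$ rows and a set of $m$ columns, not necessarily consecutive) which is itself a latin square of order $m$ on some set of $m$ symbols. Subsquares are disjoint if they share no rows, no columns and no symbols. For positive integers $h_1,\dots,h_k$ with $h_1+\dots+h_k\le n$, an incomplete latin square $\mathrm{ILS}(n;h_1\dots h_k)$ is a (completely filled) latin square of order $n$ with $k$ pairwise disjoint subsquares of orders $h_1,\dots,h_k$. In particular an $\mathrm{ILS}(n;h_1h_2h_3)$ is a latin square of order $n$ with three pairwise disjoint subsquares, of orders $h_1$, $h_2$ and $h_3$. *)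

(* Defs.v *)
From mathcomp Require Export all_boot all_order all_algebra.
Set Implicit Arguments.
Unset Strict Implicit.
Unset Printing Implicit Defensive.

(* The subarray of L on the rows R and the columns C is latin on the symbols S.
   Rows, columns and symbols are all indexed from 0. *)
Definition latin_on n (L : 'M['I_n]_n) (R C S : {set 'I_n}) : Prop :=
  [/\ forall r c, r \in R -> c \in C -> L r c \in S,
      forall r s, r \in R -> s \in S -> #|[set c in C | L r c == s]| = 1%N
    & forall c s, c \in C -> s \in S -> #|[set r in R | L r c == s]| = 1%N].

Definition latin_square n (L : 'M['I_n]_n) : Prop :=
  latin_on L [set: 'I_n] [set: 'I_n] [set: 'I_n].

Definition subsquare n (L : 'M['I_n]_n) (m : nat) (R C S : {set 'I_n}) : Prop :=
  [/\ #|R| = m, #|C| = m, #|S| = m & latin_on L R C S].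

(* The bound h_1 + ... + h_k <= n is not imposed separately: it follows from
   the disjointness of the row sets. *)
Definition is_ILS n k (h : k.-tuple nat) (L : 'M['I_n]_n) : Prop :=
  latin_square L /\
  exists R C S : 'I_k -> {set 'I_n},
    (forall i, subsquare L (tnth h i) (R i) (C i) (S i)) /\
    (forall i j, i != j ->
       [/\ [disjoint R i & R j], [disjoint C i & C j] & [disjoint S i & S j]]).

Definition ILS_exists n k (h : k.-tuple nat) : Prop :=
  exists L : 'M['I_n]_n, is_ILS h L.

(* Main.v *)
Require Import Defs.
From mathcomp Require Import all_boot all_order all_algebra.
From mathcomp Require Import zify ring.
Set Implicit Arguments.
Unset Strict Implicit.
Unset Printing Implicit Defensive.
Import Order.TTheory GRing.Theory Num.Theory.

(* Group the rows, the columns and the symbols into the classes of the holes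
   plus one leftover class (of size h4), and count the cells by the classes of
   their row, column and symbol.  Conversely (Hilton), any array of counts with
   the right margins comes from a latin square: unmerge the rows, then the
   columns, then the symbols, each time splitting a bipartite multigraph whose
   degrees are multiples of m into m parts of equal degrees.

   For three holes the margins determine the counts from the six entries
   x_abc, (a, b, c) a permutation of (1, 2, 3).  Nonnegativity means
   0 <= x_abc <= h2 h3; for a row, column or symbol class a, the two entries
   involved sum to at least W_a = h_a (h_b + h_c - h4); and the six sum to at
   most T = h4^2 - h4 (h1 + h2 + h3) + 2 (h1 h2 + h1 h3 + h2 h3).  Every such
   pair consists of an even and an odd permutation, and the row, column and
   symbol pairs of a fixed class a partition the six entries, so a solution
   exists iff one exists with value t on even and s on odd permutations, that
   is, iff p = t + s can be chosen with p >= W_a, p <= 2 h2 h3 and 3 p <= T.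
   Which W_a is largest depends on the position of h4, whence the three cases. *)

(** * Counting by fibres *)

Lemma card_setE (T : finType) (P : pred T) : #|[set x | P x]| = \sum_x P x.
Proof. by rewrite -sum1dep_card big_mkcond; apply: eq_bigr => x _; case: (P x). Qed.

Lemma card_set_fibers (D J : finType) (f : D -> J) (E : pred D) (A : {set J}) :
  #|[set d | E d && (f d \in A)]| = \sum_(j in A) #|[set d | E d && (f d == j)]|.
Proof.
rewrite -sum1dep_card (partition_big f (mem A)) /= => [|d /andP[]//].
apply: eq_bigr => j jA; rewrite -sum1dep_card; apply: eq_bigl => d.
by case: eqP => [->|_]; rewrite ?jA ?andbF ?andbT.
Qed.

Lemma card_fibers (D J : finType) (f : D -> J) (E : pred D) :
  #|[set d | E d]| = \sum_j #|[set d | E d && (f d == j)]|.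
Proof.
have := card_set_fibers f E setT; rewrite (eq_bigl _ _ (@in_setT J)) => <-.
by congr #|pred_of_set _|; apply/setP=> d; rewrite !inE andbT.
Qed.

(** * Bipartite multigraphs: subgraphs with prescribed degrees *)

(* A max-flow min-cut argument for the bipartite multigraph with edge set [D]:
   [good G] is the cut condition for [G] to contain a subgraph with degrees
   [b] and [c]. *)
Section Transversal.

Variables (D J K : finType) (f : D -> J) (g : D -> K) (b : J -> nat) (c : K -> nat).

Let cut (G : {set D}) (A : {set J}) (B : {set K}) :=
  #|[set d | (d \in G) && ((f d \in A) && (g d \notin B))]| + \sum_(k in B) c k.
Let good (G : {set D}) := [forall A : {set J}, forall B : {set K}, \sum_(j in A) b j <= cut G A B].

Let goodP (G : {set D}) : reflect (forall (A : {set J}) (B : {set K}), \sum_(j in A) b j <= cut G A B) (good G).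
Proof. exact: (iffP 'forall_forallP). Qed.

(** Submodularity holds edge by edge, and the [c] terms are modular. *)
Let cut_submodular (G : {set D}) (A A' : {set J}) (B B' : {set K}) :
  cut G (A :&: A') (B :&: B') + cut G (A :|: A') (B :|: B')
    <= cut G A B + cut G A' B'.
Proof.
have cE : \sum_(k in B :&: B') c k + \sum_(k in B :|: B') c k =
          \sum_(k in B) c k + \sum_(k in B') c k.
  rewrite 4![\sum_(k in _) _]big_mkcond -!big_split; apply: eq_bigr => k _ /=.
  by rewrite !inE; case: (k \in B); case: (k \in B'); rewrite /= ?addn0.
rewrite /cut addnACA [X in _ <= X]addnACA cE leq_add2r !card_setE -!big_split.
apply: leq_sum => d _ /=; rewrite !inE.
by case: (d \in G); case: (f d \in A); case: (f d \in A');
   case: (g d \in B); case: (g d \in B').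
Qed.

Let sum_bUI (A A' : {set J}) : \sum_(j in A :&: A') b j + \sum_(j in A :|: A') b j =
  \sum_(j in A) b j + \sum_(j in A') b j.
Proof.
rewrite 4![\sum_(j in _) _]big_mkcond -!big_split; apply: eq_bigr => j _ /=.
by rewrite !inE; case: (j \in A); case: (j \in A'); rewrite /= ?addn0.
Qed.

Let cut_setD1 (G : {set D}) d (A : {set J}) (B : {set K}) : d \in G ->
  cut G A B = cut (G :\ d) A B + (f d \in A) && (g d \notin B).
Proof.
move=> dG; rewrite /cut addnAC; congr (_ + _); rewrite !card_setE.
rewrite (bigD1 d) //= [X in _ = X + _](bigD1 d) //= !inE eqxx dG /= add0n addnC.
congr (_ + _); apply: eq_bigr => e /negbTE ne; by rewrite !inE ne.
Qed.

(* In an inclusion-minimal good set every edge lies in a tight cut; tight cuts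
   are closed under meets, so one tight cut contains all the edges at [j], and
   removing [j] from it shows that the degree of [j] is not too large. *)
Let minset_good_degree G j : minset good G ->
  #|[set d | (d \in G) && (f d == j)]| <= b j.
Proof.
case/minsetP=> /goodP gG minG; rewrite leqNgt; apply/negP=> ltbj.
pose tight (A : {set J}) (B : {set K}) := \sum_(i in A) b i = cut G A B.
have tight_edge d : d \in G -> exists A B, [/\ tight A B, f d \in A & g d \notin B].
  move=> dG; have: ~~ good (G :\ d).
    by apply/negP=> /minG/(_ (subD1set _ _)) eG; rewrite -eG !inE eqxx in dG.
  rewrite negb_forall => /existsP[A]; rewrite negb_forall => /existsP[B].
  rewrite -ltnNge => lt_cut; exists A, B.
  move: (gG A B) (lt_cut); rewrite /tight (cut_setD1 _ _ dG).
  by case: (f d \in A); case: (g d \in B) => /=; split=> //; lia.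
have tightI A B A' B' : tight A B -> tight A' B' -> tight (A :&: A') (B :&: B').
  rewrite /tight => tA tA'; have := cut_submodular G A A' B B'.
  have := gG (A :&: A') (B :&: B'); have := gG (A :|: A') (B :|: B').
  by have := sum_bUI A A'; lia.
have [A [B [tAB jA gB]]] : exists (A : {set J}) (B : {set K}), [/\ tight A B, j \in A &
    forall d, d \in [set d | (d \in G) && (f d == j)] -> g d \notin B].
  have /card_gt0P[d0] := leq_ltn_trans (leq0n _) ltbj.
  rewrite inE => /andP[d0G /eqP fd0].
  suff: forall s : seq D, {subset s <= [set d | (d \in G) && (f d == j)]} ->
      exists (A : {set J}) (B : {set K}), [/\ tight A B, j \in A & forall d, d \in s -> g d \notin B].
    move/(_ (enum [set d | (d \in G) && (f d == j)])).
    case=> [d|A [B [tAB jA gB]]]; first by rewrite mem_enum.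
    by exists A, B; split=> // d dj; apply: gB; rewrite mem_enum.
  elim=> [_|d s IH sj].
    by have [A [B [tAB jA _]]] := tight_edge _ d0G; exists A, B; rewrite -fd0.
  have /IH[A [B [tAB jA gB]]] : {subset s <= [set d | (d \in G) && (f d == j)]}.
    by move=> e es; rewrite sj // inE es orbT.
  have := sj d; rewrite !inE eqxx => /(_ isT) /andP[dG /eqP fd].
  have [A' [B' [tAB' jA' gB']]] := tight_edge _ dG.
  exists (A :&: A'), (B :&: B'); split; first exact: tightI.
    by rewrite inE jA -fd.
  move=> e; rewrite !inE => /predU1P[->|/gB/negbTE-> //].
  by rewrite (negbTE gB') andbF.
have := gG (A :\ j) B; move: tAB.
rewrite /tight (big_setD1 j jA) /= /cut => tAB.
suff: #|[set d | (d \in G) && ((f d \in A) && (g d \notin B))]| =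
      #|[set d | (d \in G) && (f d == j)]| +
      #|[set d | (d \in G) && ((f d \in A :\ j) && (g d \notin B))]| by lia.
rewrite !card_setE -big_split; apply: eq_bigr => d _ /=; rewrite !inE.
have := gB d; rewrite inE; case: (d \in G) => //=.
by case: eqP => //= -> /(_ isT) ->; rewrite jA.
Qed.

(** Giving every edge weight [1/m] meets the degrees [b] and [c] fractionally, so [E] satisfies the
    cut condition. In a minimal good subset the degrees are at most [b] by minimality and at least
    [b] and [c] by suitable cuts; equal totals force equality. *)
Lemma transversal_exists (E : {set D}) m : 0 < m ->
  (forall j, #|[set d | (d \in E) && (f d == j)]| = m * b j) ->
  (forall k, #|[set d | (d \in E) && (g d == k)]| = m * c k) ->
  exists2 G : {set D}, G \subset E &
    (forall j, #|[set d | (d \in G) && (f d == j)]| = b j) /\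
    (forall k, #|[set d | (d \in G) && (g d == k)]| = c k).
Proof.
move=> m_gt0 fE gE.
have sumE : \sum_j b j = \sum_k c k.
  apply/eqP; rewrite -(eqn_pmul2l m_gt0) !big_distrr /=.
  rewrite -(eq_bigr _ (fun j _ => fE j)) -(eq_bigr _ (fun k _ => gE k)).
  by rewrite -!(card_fibers _ (mem E)).
have goodE : good E.
  apply/goodP=> A B; rewrite -(leq_pmul2l m_gt0) /cut mulnDr !big_distrr /=.
  rewrite -(eq_bigr _ (fun j _ => fE j)) -(eq_bigr _ (fun k _ => gE k)).
  rewrite -(card_set_fibers f (mem E)) -(card_set_fibers g (mem E)).
  (* An edge starting in [A] either crosses the cut or ends in [B], so one of the [m] copies of the
     crossing edges is enough. *)
  apply: leq_trans (leq_add (leq_pmull _ m_gt0) (leqnn _)); rewrite !card_setE.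
  by rewrite -big_split; apply: leq_sum => d _ /=;
     case: (d \in E); case: (f d \in A); case: (g d \in B).
have [G mG sGE] := minset_exists goodE; exists G => //.
have /minsetP[/goodP gG _] := mG.
have degJ j : #|[set d | (d \in G) && (f d == j)]| = b j.
  apply/eqP; rewrite eqn_leq minset_good_degree //.
  have := gG [set j] set0; rewrite /cut big_set1 big_set0 addn0 => /leq_trans; apply.
  by apply/subset_leq_card/subsetP=> d; rewrite !inE andbT.
have degK k : c k <= #|[set d | (d \in G) && (g d == k)]|.
  (* In this cut [k] alone stays outside [B]; the other [c] terms cancel against the total. *)
  have := gG setT (~: [set k]); rewrite /cut (eq_bigl _ _ (@in_setT J)) sumE.
  rewrite (bigD1 k) //= (eq_bigl [in ~: [set k]]) => [|i]; last by rewrite !inE.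
  rewrite leq_add2r => /leq_trans; apply.
  by apply/subset_leq_card/subsetP=> d; rewrite !inE negbK.
split=> // k; apply/esym/eqP.
have [_ /esym] := leqif_sum (fun k (_ : xpredT k) => leqif_eq (degK k)).
rewrite -sumE -(eq_bigr _ (fun j _ => degJ j)) -!(card_fibers _ (mem G)) eqxx.
by move/forallP/(_ k).
Qed.

End Transversal.

(** * Unmerging a class into its elements *)

(** Colours are peeled off one at a time: a transversal removes degrees [b] and [c], leaving
    multiples of [#|U| - 1]. *)
Lemma equitable_coloring (D J K X : finType) (f : D -> J) (g : D -> K)
    (b : J -> nat) (c : K -> nat) (x0 : X) (E : {set D}) (U : {set X}) :
  (forall j, #|[set d | (d \in E) && (f d == j)]| = #|U| * b j) ->
  (forall k, #|[set d | (d \in E) && (g d == k)]| = #|U| * c k) ->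
  exists r : D -> X, (forall d, d \in E -> r d \in U) /\
    forall x, x \in U ->
    (forall j, #|[set d | (d \in E) && ((r d == x) && (f d == j))]| = b j) /\
    (forall k, #|[set d | (d \in E) && ((r d == x) && (g d == k))]| = c k).
Proof.
move: {2}#|U| (erefl #|U|) => m; elim: m => [|m IH] in U E *.
  (* Without colours all degrees vanish, so [E] is empty and [x0] is a dummy value. *)
  move=> /cards0_eq-> fE _; exists (fun=> x0); split=> [d dE|x]; last by rewrite inE.
  have := fE (f d); rewrite cards0 mul0n => /cards0_eq/setP/(_ d).
  by rewrite !inE dE eqxx.
move=> Um fE gE; have [x xU] : exists x, x \in U by apply/card_gt0P; rewrite Um.
rewrite Um in fE gE; have [G sGE [fG gG]] := transversal_exists (ltn0Sn m) fE gE.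
have Um' : #|U :\ x| = m by move: Um; rewrite (cardsD1 x) xU => -[].
have splitE (P : pred D) : #|[set d | (d \in E) && P d]| =
    #|[set d | (d \in G) && P d]| + #|[set d | (d \in E :\: G) && P d]|.
  rewrite !card_setE -big_split; apply: eq_bigr => d _ /=; rewrite inE.
  by have /implyP := subsetP sGE d; case: (d \in E); case: (d \in G); case: (P d).
have [|j|k|r [rU cr]] := IH (U :\ x) (E :\: G) => //.
- by apply/eqP; rewrite -(eqn_add2l (b j)) -{1}fG -splitE fE Um' mulSn.
- by apply/eqP; rewrite -(eqn_add2l (c k)) -{1}gG -splitE gE Um' mulSn.
exists (fun d => if d \in G then x else r d); split=> [d dE|y yU].
  case: ifP => // /negbT dG; have := rU d; rewrite inE dG dE => /(_ isT).
  by rewrite inE => /andP[].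
have [->|neq_yx] := eqVneq y x.
  have rG (P : pred D) :
    #|[set d | (d \in E) && (((if d \in G then x else r d) == x) && P d)]| =
    #|[set d | (d \in G) && P d]|.
    apply: eq_card => d; rewrite !inE; case: ifP => [/(subsetP sGE)->|dG].
      by rewrite eqxx.
    case dE: (d \in E) => //=; have := rU d; rewrite 3!inE dG dE => /(_ isT).
    by case/andP=> /negbTE->.
  by split=> i; rewrite rG.
have rG (P : pred D) :
    #|[set d | (d \in E) && (((if d \in G then x else r d) == y) && P d)]| =
    #|[set d | (d \in E :\: G) && ((r d == y) && P d)]|.
  apply: eq_card => d; rewrite !inE; case: ifP => //= _.
  by rewrite [x == y]eq_sym (negbTE neq_yx) andbF.
have [|fr gr] := cr y; first by rewrite !inE neq_yx.
by split=> i; rewrite rG.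
Qed.

(** Each fibre of [a] is coloured separately, its colours being the elements of the matching class
    of [t]. *)
Lemma coordinate_lift (D I J K X : finType) (x0 : X) (t : X -> I) (a : D -> I)
    (f : D -> J) (g : D -> K) (b : J -> nat) (c : K -> nat) :
  (forall i j, #|[set d | (a d == i) && (f d == j)]| =
     #|[set x | t x == i]| * b j) ->
  (forall i k, #|[set d | (a d == i) && (g d == k)]| =
     #|[set x | t x == i]| * c k) ->
  exists r : D -> X, [/\ forall d, t (r d) = a d,
    forall x j, #|[set d | (r d == x) && (f d == j)]| = b j &
    forall x k, #|[set d | (r d == x) && (g d == k)]| = c k].
Proof.
move=> fa ga.
have setI1 i (P : pred D) :
    #|[set d | (d \in [set d | a d == i]) && P d]| = #|[set d | (a d == i) && P d]|.
  by apply: eq_card => d; rewrite !inE.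
have /fin_all_exists[r rP] i := equitable_coloring (E := [set d | a d == i]) x0
  (fun j => etrans (setI1 i _) (fa i j)) (fun k => etrans (setI1 i _) (ga i k)).
have tr d : t (r (a d) d) = a d.
  by have [/(_ d)] := rP (a d); rewrite !inE eqxx => /(_ isT)/eqP.
have rE x (P : pred D) : #|[set d | (r (a d) d == x) && P d]| =
    #|[set d | (d \in [set d | a d == t x]) && ((r (t x) d == x) && P d)]|.
  apply: eq_card => d; rewrite !inE; case: eqP => [<-|ne] /=.
    by rewrite tr !eqxx.
  by case: eqP => //= <-; case: eqP.
exists (fun d => r (a d) d); split=> // x i; rewrite rE;
  by have [_ /(_ x)] := rP (t x); rewrite inE eqxx => /(_ isT)[].
Qed.

(** * From outlines to latin squares *)

(* [O i j k] is the number of cells with row class [i], column class [j] and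
   symbol class [k], where class [i] has size [h i]. *)
Definition outline (I : finType) (h : I -> nat) (O : I -> I -> I -> nat) :=
  [/\ forall i j, \sum_k O i j k = h i * h j,
      forall i k, \sum_j O i j k = h i * h k &
      forall j k, \sum_i O i j k = h j * h k].

(** Rows, columns and symbols are unmerged in turn, each lift keeping the pair counts that the later
    ones need. In the end any two coordinates determine a unique cell. *)
Lemma outline_lift (X I : finType) (t : X -> I) (O : I -> I -> I -> nat) :
  outline (fun i => #|[set x | t x == i]|) O ->
  exists L : X -> X -> X,
    [/\ forall x, injective (L x), forall y, injective (L ^~ y) &
        forall x y, O (t x) (t y) (t (L x y)) != 0].
Proof.
case=> Oij Oik Ojk; have [x0|X0] := pickP X; last first.
  by exists (fun x _ => x); split=> x; have := X0 x.
(* One element for each cell counted by [O], so far known only by its three classes. *)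
pose D : finType := {v : I * I * I & 'I_(O v.1.1 v.1.2 v.2)}.
pose ri (d : D) := (tag d).1.1; pose ci (d : D) := (tag d).1.2.
pose si (d : D) := (tag d).2.
have cardD (P : pred (I * I * I)) : #|[set d : D | P (tag d)]| =
    \sum_(v | P v) O v.1.1 v.1.2 v.2.
  rewrite -sum1dep_card (eq_bigr (fun v => \sum_(d : 'I_(O v.1.1 v.1.2 v.2)) 1)).
    by rewrite (sig_big_dep P (fun _ => xpredT)) /=; apply: eq_bigl => d; rewrite andbT.
  by move=> v _; rewrite sum1_card card_ord.
have rc i j : #|[set d | (ri d == i) && (ci d == j)]| =
    #|[set x | t x == i]| * #|[set x | t x == j]|.
  rewrite -Oij (cardD (fun v => (v.1.1 == i) && (v.1.2 == j))).
  rewrite (reindex_onto (fun k => (i, j, k)) (fun v => v.2)) /=.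
    by apply: eq_bigl => k; rewrite !eqxx.
  by move=> [[? ?] ?] /andP[/eqP<- /eqP<-].
have rs i j : #|[set d | (ri d == i) && (si d == j)]| =
    #|[set x | t x == i]| * #|[set x | t x == j]|.
  rewrite -Oik (cardD (fun v => (v.1.1 == i) && (v.2 == j))).
  rewrite (reindex_onto (fun k => (i, k, j)) (fun v => v.1.2)) /=.
    by apply: eq_bigl => k; rewrite !eqxx.
  by move=> [[? ?] ?] /andP[/eqP<- /eqP<-].
have cs i j : #|[set d | (ci d == i) && (si d == j)]| =
    #|[set x | t x == i]| * #|[set x | t x == j]|.
  rewrite -Ojk (cardD (fun v => (v.1.2 == i) && (v.2 == j))).
  rewrite (reindex_onto (fun k => (k, i, j)) (fun v => v.1.1)) /=.
    by apply: eq_bigl => k; rewrite !eqxx.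
  by move=> [[? ?] ?] /andP[/eqP<- /eqP<-].
have [r [tr rc1 rs1]] := coordinate_lift x0 rc rs.
have [c [tc cr2 cs2]] : exists c : D -> X, [/\ forall d, t (c d) = ci d,
    forall y x, #|[set d | (c d == y) && (r d == x)]| = 1%N &
    forall y k, #|[set d | (c d == y) && (si d == k)]| = #|[set x | t x == k]|].
  apply: coordinate_lift => // j x; rewrite muln1 -(rc1 x).
  by apply: eq_card => d; rewrite !inE andbC.
have [s [ts sr3 sc3]] : exists s : D -> X, [/\ forall d, t (s d) = si d,
    forall z x, #|[set d | (s d == z) && (r d == x)]| = 1%N &
    forall z y, #|[set d | (s d == z) && (c d == y)]| = 1%N].
  apply: coordinate_lift => // k x; rewrite muln1.
    by rewrite -(rs1 x); apply: eq_card => d; rewrite !inE andbC.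
  by rewrite -(cs2 x); apply: eq_card => d; rewrite !inE andbC.
have uniq1 (A : {set D}) : #|A| = 1%N -> {in A &, forall d e, d = e}.
  by move/eqP/cards1P=> [e ->] u v; rewrite !inE => /eqP-> /eqP->.
have /fin_all_exists[q qP] : forall v : X * X, exists d, r d = v.1 /\ c d = v.2.
  move=> [x y]; have /eqP/cards1P[d /setP/(_ d)] := cr2 y x.
  by rewrite !inE eqxx => /andP[/eqP ? /eqP ?]; exists d.
exists (fun x y => s (q (x, y))); split=> [x y y' eq_s|y x x' eq_s|x y].
- have [[rq cq] [rq' cq']] := (qP (x, y), qP (x, y')).
  suff eq_q : q (x, y) = q (x, y') by rewrite -[y]cq -[y']cq' eq_q.
  by apply: (uniq1 _ (sr3 (s (q (x, y))) x)); rewrite !inE ?rq ?rq' ?eq_s !eqxx.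
- have [[rq cq] [rq' cq']] := (qP (x, y), qP (x', y)).
  suff eq_q : q (x, y) = q (x', y) by rewrite -[x]rq -[x']rq' eq_q.
  by apply: (uniq1 _ (sc3 (s (q (x, y))) y)); rewrite !inE ?cq ?cq' ?eq_s !eqxx.
have [rq cq] := qP (x, y); rewrite ts -lt0n.
have -> : t x = ri (q (x, y)) by rewrite -tr rq.
have -> : t y = ci (q (x, y)) by rewrite -tc cq.
(* The cell carries an ordinal below this count, so the count is positive. *)
by have := ltn_ord (tagged (q (x, y))); apply: leq_ltn_trans.
Qed.

(** * Latin squares with holes as outlines *)

(** An injection between finite sets of equal size is a bijection. *)
Lemma latin_on_injective n (L : 'M['I_n]_n) (R C S : {set 'I_n}) :
  #|R| = #|C| -> #|C| = #|S| ->
  (forall r c, r \in R -> c \in C -> L r c \in S) ->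
  (forall r, injective (L r)) -> (forall c, injective (L ^~ c)) ->
  latin_on L R C S.
Proof.
move=> RC CS LS injr injc.
have unique_preimage (f : 'I_n -> 'I_n) (A : {set 'I_n}) s : injective f ->
    #|A| = #|S| -> {in A, forall x, f x \in S} -> s \in S ->
    #|[set x in A | f x == s]| = 1%N.
  move=> injf AS fAS sS.
  have /eqP fA : f @: A == S.
    rewrite eqEcard (card_imset _ injf) AS leqnn andbT.
    by apply/subsetP=> _ /imsetP[x xA ->]; apply: fAS.
  move: sS; rewrite -fA => /imsetP[x xA ->]; apply/eqP/cards1P; exists x.
  by apply/setP=> y; rewrite !inE (inj_eq injf) andb_idl // => /eqP->.
split=> // [r s rR | c s cC]; apply: unique_preimage => //.
- by move=> c; apply: LS.
- by rewrite RC.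
- by move=> r rR; apply: LS.
Qed.

Lemma latin_square_row_inj n (L : 'M['I_n]_n) r : latin_square L -> injective (L r).
Proof.
case=> _ /(_ r) row1 _ c c' eqL.
have /eqP/cards1P[e /setP Le] := row1 (L r c') (in_setT _) (in_setT _).
have := Le c; have := Le c'; rewrite !inE eqL eqxx.
by move=> /esym/eqP-> /esym/eqP->.
Qed.

Lemma latin_square_col_inj n (L : 'M['I_n]_n) c : latin_square L -> injective (L ^~ c).
Proof.
case=> _ _ /(_ c) col1 r r' eqL.
have /eqP/cards1P[e /setP Le] := col1 (L r' c) (in_setT _) (in_setT _).
have := Le r; have := Le r'; rewrite !inE eqL eqxx.
by move=> /esym/eqP-> /esym/eqP->.
Qed.

Lemma labelling_exists (I : finType) (h : I -> nat) n : n = \sum_i h i ->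
  exists t : 'I_n -> I, forall i, #|[set x | t x == i]| = h i.
Proof.
pose T : finType := {i : I & 'I_(h i)} => hn.
have cardT (P : pred I) : #|[set u : T | P (tag u)]| = \sum_(i | P i) h i.
  rewrite -sum1dep_card (eq_bigr (fun i => \sum_(d : 'I_(h i)) 1)).
    by rewrite (sig_big_dep P (fun _ => xpredT)) /=; apply: eq_bigl => d; rewrite andbT.
  by move=> i _; rewrite sum1_card card_ord.
have nT : n = #|T|.
  by rewrite hn -cardsT -(cardT xpredT); apply: eq_card => u; rewrite !inE.
exists (fun x => tag (enum_val (cast_ord nT x))) => i.
rewrite -(big_pred1_eq addn i h) -(cardT (pred1 i)).
rewrite -(card_imset _ (inj_comp enum_val_inj (@cast_ord_inj _ _ nT))).
apply: eq_card => u; rewrite inE; apply/imsetP/idP => [[x + ->]|ui].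
  by rewrite inE.
exists (cast_ord (esym nT) (enum_rank u)); last by rewrite /= cast_ordKV enum_rankK.
by rewrite inE cast_ordKV enum_rankK.
Qed.

Lemma sum_option (I : finType) (F : option I -> nat) :
  \sum_o F o = \sum_i F (Some i) + F None.
Proof.
rewrite (bigD1 None) //= addnC (reindex_omap Some id) => [|[]//].
by congr (_ + _); apply: eq_bigl => i; rewrite /= eqxx.
Qed.

(** Disjointness makes the picked index unambiguous; comparing totals gives the size of the [None]
    class. *)
Lemma disjoint_labelling n k (h : k.-tuple nat) (w : nat) (A : 'I_k -> {set 'I_n}) :
  n = \sum_i tnth h i + w -> (forall i, #|A i| = tnth h i) ->
  (forall i j, i != j -> [disjoint A i & A j]) ->
  exists t : 'I_n -> option 'I_k,
    (forall i x, (t x == Some i) = (x \in A i)) /\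
    (forall o, #|[set x | t x == o]| = oapp (tnth h) w o).
Proof.
move=> hn cardA disA.
have tA i x : ([pick i | x \in A i] == Some i) = (x \in A i).
  case: pickP => [j xj|xA]; last by rewrite xA.
  apply/eqP/idP => [[<-] // |xi]; congr Some; apply/eqP/negPn/negP=> /disA dis.
  by have := disjointFr dis xj; rewrite xi.
exists (fun x => [pick i | x \in A i]); split=> // -[i|] /=.
  by rewrite -cardA; apply: eq_card => x; rewrite inE tA.
have := card_fibers (fun x : 'I_n => [pick i | x \in A i]) xpredT.
rewrite cardsT card_ord sum_option [X in _ = X + _](eq_bigr (tnth h)) => [|i _].
  by rewrite {1}hn => /addnI.
by rewrite -cardA; apply: eq_card => x; rewrite inE tA.
Qed.

(* The class [None] collects the [w] rows, columns and symbols outside the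
   subsquares. *)
Lemma ILS_outline n k (h : k.-tuple nat) (w : nat) : n = \sum_i tnth h i + w ->
  ILS_exists n h <->
  exists O : option 'I_k -> option 'I_k -> option 'I_k -> nat,
    outline (oapp (tnth h) w) O /\
    forall i, O (Some i) (Some i) (Some i) = tnth h i * tnth h i.
Proof.
move=> hn; split=> [[L [latL [R [C [S [sub dis]]]]]]|[O [outO Oiii]]].
  have [|||tr [trR cardr]] := @disjoint_labelling n k h w R => //.
  - by move=> i; have [] := sub i.
  - by move=> i j /dis[].
  have [|||tc [tcC cardc]] := @disjoint_labelling n k h w C => //.
  - by move=> i; have [] := sub i.
  - by move=> i j /dis[].
  have [|||ts [tsS cards]] := @disjoint_labelling n k h w S => //.
  - by move=> i; have [] := sub i.
  - by move=> i j /dis[].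
  have prod2 (P Q : pred 'I_n) : \sum_x \sum_y (P x && Q y) =
      #|[set x | P x]| * #|[set y | Q y]|.
    rewrite !card_setE big_distrl; apply: eq_bigr => x _ /=; rewrite big_distrr /=.
    by apply: eq_bigr => y _; rewrite mulnb.
  have sum_eq (o : option 'I_k) : \sum_i (o == i) = 1%N.
    rewrite (bigD1 o) //= eqxx big1 // => i.
    by rewrite eq_sym => /negbTE->.
  have sum_and (P : 'I_n -> 'I_n -> bool) (f : 'I_n -> 'I_n -> option 'I_k) :
     \sum_j \sum_x \sum_y (P x y && (f x y == j)) = \sum_x \sum_y P x y.
    rewrite exchange_big; apply: eq_bigr => x _ /=.
    rewrite exchange_big; apply: eq_bigr => y _ /=.
    by case: (P x y) => /=; [rewrite sum_eq|rewrite big1].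
  exists (fun i j k => \sum_x \sum_y [&& tr x == i, tc y == j & ts (L x y) == k]).
  split=> [|i].
    split=> [i j|i j|i j].
    - under eq_bigr do under eq_bigr do under eq_bigr do rewrite andbA.
      by rewrite sum_and prod2 cardr cardc.
    - under eq_bigr do under eq_bigr do under eq_bigr do rewrite andbCA andbC.
      rewrite sum_and -cardr -cards -prod2; apply: eq_bigr => x _ /=.
      by rewrite [RHS](reindex_inj (@latin_square_row_inj _ _ x latL)) /=; apply: eq_bigr.
    - under eq_bigr do under eq_bigr do under eq_bigr do rewrite andbC.
      rewrite sum_and -cardc -cards -prod2 exchange_big; apply: eq_bigr => y _ /=.
      by rewrite [RHS](reindex_inj (@latin_square_col_inj _ _ y latL)) /=; apply: eq_bigr.
  have [Ri Ci _ [Li _ _]] := sub i; rewrite -{1}Ri -Ci.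
  have -> : #|R i| = #|[set x | x \in R i]| by apply: eq_card => x; rewrite inE.
  have -> : #|C i| = #|[set x | x \in C i]| by apply: eq_card => x; rewrite inE.
  rewrite -prod2; apply: eq_bigr => x _; apply: eq_bigr => y _.
  rewrite trR tcC tsS; case xR: (x \in R i) => //=; case yC: (y \in C i) => //=.
  by rewrite Li.
(* A single labelling serves rows, columns and symbols alike. *)
have [|t cardt] := @labelling_exists (option 'I_k) (oapp (tnth h) w) n.
  by rewrite sum_option.
have outO' : outline (fun i => #|[set x | t x == i]|) O.
  by have [O1 O2 O3] := outO; split=> i j; rewrite !cardt.
have [f [frow fcol fO]] := outline_lift outO'.
pose L : 'M_n := (\matrix_(x, y) f x y)%R.
have rowL r : injective (L r) by move=> c c'; rewrite !mxE; apply: frow.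
have colL c : injective (L ^~ c) by move=> r r'; rewrite !mxE; apply: fcol.
exists L; split; first by apply: latin_on_injective => // *; rewrite inE.
pose A i := [set x | t x == Some i]; exists A, A, A; split=> [i|i j ij].
  split; rewrite ?cardt //; apply: latin_on_injective => // r c.
  rewrite !inE => /eqP tr /eqP tc; have := fO r c; rewrite tr tc mxE.
  (* The diagonal count already fills the block, so no cell there has a symbol of another class. *)
  have [O1 _ _] := outO; have := O1 (Some i) (Some i).
  rewrite (bigD1 (Some i)) //= Oiii -[RHS]addn0 => /eqP.
  rewrite eqn_add2l sum_nat_eq0 => /forallP/(_ (t (f r c)))/implyP Oi0.
  by apply: contraR => /Oi0.
have disA : [disjoint A i & A j].
  rewrite -setI_eq0; apply/eqP/setP=> x; rewrite !inE.
  by apply/negbTE; apply: contra ij => /andP[/eqP-> /eqP[->]].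
by [].
Qed.

(** * Outlines with three holes *)

Lemma sum_option3 (F : option 'I_3 -> nat) :
  \sum_o F o = F (Some (inord 0)) + F (Some (inord 1)) + F (Some (inord 2)) + F None.
Proof.
rewrite sum_option !big_ord_recl big_ord0 addn0 !addnA.
by congr (F (Some _) + F (Some _) + F (Some _) + F None); apply/val_inj; rewrite /= inordK.
Qed.

Section ThreeHoles.

Variables h1 h2 h3 w : nat.

Let h := [tuple h1; h2; h3].
Let hh := oapp (tnth h) w.
Let T := w ^ 2 + 2 * (h1 * h2 + h1 * h3 + h2 * h3).

(** Each of the six entries involves classes 2 and 3, so a margin bounds it by [h2 * h3]; a pair of
    class 1 or 2 then gives the first two bounds. The third adds the row, column and symbol pairs of
    class 1, which exhaust the six entries, and uses [O d d d >= 0]. *)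
Lemma outline3_necessary (O : option 'I_3 -> option 'I_3 -> option 'I_3 -> nat) :
  outline hh O ->
  (forall i, O (Some i) (Some i) (Some i) = tnth h i * tnth h i) ->
  [/\ h1 * (h2 + h3) <= h1 * w + 2 * (h2 * h3),
      h2 * (h1 + h3) <= h2 * w + 2 * (h2 * h3) &
      3 * (h1 * (h2 + h3)) + w * (h1 + h2 + h3) <= T + 3 * (h1 * w)].
Proof.
case=> Oij Oik Ojk Od; rewrite /T.
set a : option 'I_3 := Some (inord 0); set b : option 'I_3 := Some (inord 1).
set c : option 'I_3 := Some (inord 2); set d : option 'I_3 := None.
have [ha hb hc hd] : [/\ hh a = h1, hh b = h2, hh c = h3 & hh d = w].
  by rewrite /hh /= !(tnth_nth 0) !inordK.
have Ma : O a a a = h1 * h1 by rewrite Od -ha.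
have Mb : O b b b = h2 * h2 by rewrite Od -hb.
have Mc : O c c c = h3 * h3 by rewrite Od -hc.
have I i j : O i j a + O i j b + O i j c + O i j d = hh i * hh j.
  by rewrite -Oij sum_option3.
have J i k : O i a k + O i b k + O i c k + O i d k = hh i * hh k.
  by rewrite -Oik sum_option3.
have K j k : O a j k + O b j k + O c j k + O d j k = hh j * hh k.
  by rewrite -Ojk sum_option3.
clearbody a b c d.
(* From these margins the claims follow linearly, with products of sizes as atoms. *)
move: (I a a) (I b b) (I c c) (J a a) (J d a) (J b d)
  (J c d) (K a b) (K a c) (K b a) (K c a) (K d d)
  (I b c) (I b a) (I c a) (I c b) (I d a) (I d b).
clear Oij Oik Ojk Od I J K; rewrite !(ha, hb, hc, hd) => *; split; lia.
Qed.

(* Classes 0, 1, 2 are the holes and 3 is the leftover class.  The even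
   permutations of (0, 1, 2) get [t] and the odd ones [s]; the margins force the
   rest.  The truncated subtractions are exact under the hypotheses of
   [outline3_exists]. *)
Definition outline3 (t s : nat) (i j k : nat) : nat :=
  match i, j, k with
  | 0, 0, 0 => h1 * h1
  | 1, 1, 1 => h2 * h2
  | 2, 2, 2 => h3 * h3
  | 0, 1, 2 | 1, 2, 0 | 2, 0, 1 => t
  | 0, 2, 1 | 2, 1, 0 | 1, 0, 2 => s
  | 0, 1, 3 | 3, 0, 1 | 1, 3, 0 => h1 * h2 - t
  | 1, 0, 3 | 3, 1, 0 | 0, 3, 1 => h1 * h2 - s
  | 1, 2, 3 | 3, 1, 2 | 2, 3, 1 => h2 * h3 - t
  | 2, 1, 3 | 3, 2, 1 | 1, 3, 2 => h2 * h3 - s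
  | 2, 0, 3 | 3, 2, 0 | 0, 3, 2 => h1 * h3 - t
  | 0, 2, 3 | 3, 0, 2 | 2, 3, 0 => h1 * h3 - s
  | 0, 3, 3 | 3, 0, 3 | 3, 3, 0 => h1 * w + (t + s) - h1 * (h2 + h3)
  | 1, 3, 3 | 3, 1, 3 | 3, 3, 1 => h2 * w + (t + s) - h2 * (h1 + h3)
  | 2, 3, 3 | 3, 2, 3 | 3, 3, 2 => h3 * w + (t + s) - h3 * (h1 + h2)
  | 3, 3, 3 => T - (3 * (t + s) + w * (h1 + h2 + h3))
  | _, _, _ => 0
  end.

Lemma outline3_exists t s :
  [&& t <= h1 * h2, t <= h1 * h3 & t <= h2 * h3] ->
  [&& s <= h1 * h2, s <= h1 * h3 & s <= h2 * h3] ->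
  [/\ h1 * (h2 + h3) <= h1 * w + (t + s), h2 * (h1 + h3) <= h2 * w + (t + s) &
      h3 * (h1 + h2) <= h3 * w + (t + s)] ->
  3 * (t + s) + w * (h1 + h2 + h3) <= T ->
  exists O : option 'I_3 -> option 'I_3 -> option 'I_3 -> nat,
    outline hh O /\
    forall i, O (Some i) (Some i) (Some i) = tnth h i * tnth h i.
Proof.
move=> /and3P[t12 t13 t23] /and3P[s12 s13 s23] [W1 W2 W3] leT.
pose code (o : option 'I_3) := oapp val 3 o.
exists (fun i j k => outline3 t s (code i) (code j) (code k)); split; last first.
  by case=> [[|[|[|]]]] //= lti; rewrite (tnth_nth 0).
(* Code 3 lies past the end of the list, so the default of [nth] supplies [w]. *)
have hhE o : hh o = nth w [:: h1; h2; h3] (code o).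
  by case: o => [[[|[|[|]]] //= lti]|] //=; rewrite /hh /= (tnth_nth 0).
have codeP o : code o < 4 by case: o => [[]|]//= m; lia.
have sumE F : \sum_o F (code o) = F 0 + F 1 + F 2 + F 3.
  by rewrite sum_option3 /code /= !inordK.
split=> i j; rewrite !hhE.
- rewrite (sumE (outline3 t s (code i) (code j))).
  case: (code i) (codeP i) => [|[|[|[|]]]] // _;
  by case: (code j) (codeP j) => [|[|[|[|]]]] // _ /=; rewrite /T in leT *; lia.
- rewrite (sumE (fun l => outline3 t s (code i) l (code j))).
  case: (code i) (codeP i) => [|[|[|[|]]]] // _;
  by case: (code j) (codeP j) => [|[|[|[|]]]] // _ /=; rewrite /T in leT *; lia.
rewrite (sumE (fun l => outline3 t s l (code i) (code j))).
case: (code i) (codeP i) => [|[|[|[|]]]] // _;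
by case: (code j) (codeP j) => [|[|[|[|]]]] // _ /=; rewrite /T in leT *; lia.
Qed.

End ThreeHoles.

(** * The numerical criterion *)

Lemma sum_tuple3 h1 h2 h3 : \sum_i tnth [tuple h1; h2; h3] i = h1 + h2 + h3.
Proof. by rewrite !big_ord_recl big_ord0 addn0 addnA !(tnth_nth 0). Qed.

(** The smallest of the three products is [h2 * h3], so [p] splits into two admissible parts as soon
    as it is at most twice that. *)
Lemma ILS3_sufficient h1 h2 h3 w p : h2 <= h1 -> h3 <= h2 ->
  p <= 2 * (h2 * h3) ->
  [/\ h1 * (h2 + h3) <= h1 * w + p, h2 * (h1 + h3) <= h2 * w + p &
      h3 * (h1 + h2) <= h3 * w + p] ->
  3 * p + w * (h1 + h2 + h3) <= w ^ 2 + 2 * (h1 * h2 + h1 * h3 + h2 * h3) ->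
  ILS_exists (h1 + h2 + h3 + w) [tuple h1; h2; h3].
Proof.
move=> h12 h23 lep W leT.
have le12 : h2 * h3 <= h1 * h2 by rewrite mulnC leq_mul ?(leq_trans h23).
have le13 : h2 * h3 <= h1 * h3 by rewrite leq_mul.
pose t := minn p (h2 * h3).
have [lt eq_p] : t <= h2 * h3 /\ p = t + (p - t) by rewrite /t; lia.
have ls : p - t <= h2 * h3 by rewrite /t; lia.
apply/(ILS_outline (w := w)); first by rewrite sum_tuple3.
apply: (@outline3_exists _ _ _ _ t (p - t)); rewrite -?eq_p //; apply/and3P; split; lia.
Qed.

(** Clearing the denominator [h1] turns the bound into [W_1 <= 2 h2 h3]. *)
Lemma rat_bound_nat (h1 h2 h3 h4 : nat) : 0 < h1 ->
  (h2%:Q + h3%:Q - 2%:R * (h2%:Q * h3%:Q / h1%:Q) <= h4%:Q)%R =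
  (h1 * (h2 + h3) <= h1 * h4 + 2 * (h2 * h3)).
Proof.
move=> h1_gt0; have h1Q : (0 < h1%:Q)%R by rewrite ltr0z.
have h1Q0 : (h1%:Q != 0)%R by rewrite gt_eqF.
rewrite -(ler_pM2l h1Q) mulrBr lerBlDr.
rewrite [X in (_ <= _ + X)%R](_ : _ = 2%:R * (h2%:Q * h3%:Q))%R; last by field.
by rewrite -!pmulrn -!natrD -!natrM -!natrD ler_nat.
Qed.

Theorem theorem4p2 (h1 h2 h3 h4 n : nat)
    (h12 : (h2 <= h1)%N) (h23 : (h3 <= h2)%N) (h3_gt0 : (0 < h3)%N)
    (hn : n = (h1 + h2 + h3 + h4)%N) :
  [/\ (h1 <= h4)%N -> ILS_exists n [tuple h1; h2; h3],
      (h4 < h1)%N -> (h3 <= h4)%N ->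
        (ILS_exists n [tuple h1; h2; h3] <->
         (h1%:Z - h3%:Z <= h4%:Z)%R)
    & (h4 < h3)%N ->
        (ILS_exists n [tuple h1; h2; h3] <->
         (h2%:Q + h3%:Q - 2%:R * (h2%:Q * h3%:Q / h1%:Q) <= h4%:Q)%R /\
         (0 <= h4%:Z ^+ 2 + h4%:Z * (2%:R * h1%:Z - h2%:Z - h3%:Z)
               - h1%:Z * h2%:Z - h1%:Z * h3%:Z + 2%:R * h2%:Z * h3%:Z)%R)].
Proof.
have necessary : ILS_exists n [tuple h1; h2; h3] ->
  [/\ h1 * (h2 + h3) <= h1 * h4 + 2 * (h2 * h3),
      h2 * (h1 + h3) <= h2 * h4 + 2 * (h2 * h3) &
      3 * (h1 * (h2 + h3)) + h4 * (h1 + h2 + h3) <=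
      h4 ^ 2 + 2 * (h1 * h2 + h1 * h3 + h2 * h3) + 3 * (h1 * h4)].
  case/(ILS_outline (w := h4)) => [|O [outO Od]]; first by rewrite sum_tuple3.
  exact: outline3_necessary outO Od.
split=> [h41|h41 h34|h43].
(* In each case [p] is the largest [W_a], found from [W_a - W_b = (h_a - h_b) (h_c - h4)]. Here it
   is [W_3], with truncation replacing a negative value by 0. *)
- rewrite hn; apply: (@ILS3_sufficient _ _ _ _ (h3 * (h1 + h2 - h4))) => //.
  + by nia.
  + by split; nia.
  + by nia.
(* Now [W_2] is the largest; dividing [W_2 <= 2 h2 h3] by [h2] gives the stated condition. *)
- split=> [/necessary[_ W2 _]|le_h4]; first by nia.
  rewrite hn; apply: (@ILS3_sufficient _ _ _ _ (h2 * (h1 + h3 - h4))) => //.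
  + by nia.
  + by split; nia.
  + by nia.
have h1_gt0 : 0 < h1 by lia.
(* Now [W_1] is the largest, and the quadratic form equals [T - 3 W_1]. *)
rewrite rat_bound_nat //; split=> [/necessary[W1 _ leT]|[W1 leT]]; first by split=> //; nia.
rewrite hn; apply: (@ILS3_sufficient _ _ _ _ (h1 * (h2 + h3 - h4))) => //.
+ by nia.
+ by split; nia.
+ by nia.
Qed.
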